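(* For $n\ge 0$ let $\mathcal{S}_n$ be the Shi arrangement in $\mathbb{R}^n$, consisting of the hyperplanes $x_i-x_j=0$ and $x_i-x_j=1$ for $1\le i<j\le n$. Let $$A_r(x)=\sum_{n=0}^r(r-n)^n\frac{x^n}{n!}.$$ Then $$\sum_{n\ge 0}\chi_{\mathcal{S}_n}(q)\frac{x^n}{n!}=\left(\lim_{r\to\infty}\frac{A_r(x)}{A_{r-1}(x)}\right)^q.$$ In particular, $$\sum_{n\ge 0}(-1)^n(n+1)^{n-1}\frac{x^n}{n!}=\lim_{r\to\infty}\frac{A_{r-1}(x)}{A_r(x)}.$$ The limits are in the sense of convergence of formal power series.
   Context: For a hyperplane arrangement $\mathcal{A}$ (finite set of affine hyperplanes) in $\mathbb{R}^n$, the intersection poset $L_{\mathcal{A}}$ is the set of non-empty intersections of subsets of $\mathcal{A}$ (including the empty intersection $\hat 0=\mathbb{R}^n$), ordered by reverse inclusion; $r(x)=n-\dim x$ for $x\in L_{\mathcal{A}}$. The characteristic polynomial is $\chi_{\mathcal{A}}(q)=\sum_{x\in L_{\mathcal{A}}}\mu(\hat 0,x)\,q^{n-r(x)}$, where $\mu$ is the Möbius function of $L_{\mathcal{A}}$ (so it is $1$ for $n=0$). For a formal power series $F$ in $x$ with constant term $1$, $F^q=\exp(q\log F)$, with $q$ an indeterminate. Convergence: $\lim_{r\to\infty}F_r(x)=F(x)$ means that for every $b$ the coefficient of $x^b$ in $F_r(x)$ equals that in $F(x)$ for all sufficiently large $r$. The convention $0^0=1$ is used. *)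

(* Defs.v *)
From HB Require Import structures.
From mathcomp Require Import all_boot all_order all_algebra.
From mathcomp Require Import finmap.
From mathcomp Require Import boolp classical_sets filter reals.

Set Implicit Arguments.
Unset Strict Implicit.
Unset Printing Implicit Defensive.

Import Order.TTheory GRing.Theory Num.Theory.
Local Open Scope classical_set_scope.
Local Open Scope ring_scope.

Definition is_hyperplane (R : realType) (n : nat) (H : set 'rV[R]_n) : Prop :=
  exists (a : 'rV[R]_n) (b : R),
    a != 0 /\ H = [set x : 'rV[R]_n | \sum_(i < n) a 0 i * x 0 i = b].

Record arrangement (R : realType) (n : nat) := Arrangement {
  hyperplanes :> {fset set 'rV[R]_n};
  hyperplanesP : forall H, H \in hyperplanes -> is_hyperplane H }.

Definition flats (R : realType) (n : nat) (A : arrangement R n) :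
    {fset set 'rV[R]_n} :=
  [fset X in [fset \bigcap_(H in [set` B]) H | B : {fset set 'rV[R]_n}
                                             in fpowerset A]
  | X != set0]%fset.

Lemma setT_flats (R : realType) (n : nat) (A : arrangement R n) :
  [set: 'rV[R]_n] \in flats A.
Proof.
rewrite !inE /=; apply/andP; split; last by apply/set0P; exists 0.
apply/imfsetP; exists fset0; first by rewrite /= fpowersetE fsub0set.
by apply/seteqP; split => // x _ H /=; rewrite inE.
Qed.

Definition intersection_poset (R : realType) (n : nat) (A : arrangement R n) :
  Type := flats A.

HB.instance Definition _ (R : realType) (n : nat) (A : arrangement R n) :=
  Finite.on (intersection_poset A).

Fact flat_display : Order.disp_t. Proof. exact: Order.Disp tt tt. Qed.

Section IntersectionPoset.
Context (R : realType) (n : nat) (A : arrangement R n).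
Implicit Types X Y Z : intersection_poset A.

Definition flat_set X : set 'rV[R]_n := fsval X.

Definition flat_le X Y : bool := `[< flat_set Y `<=` flat_set X >].

Fact flat_le_refl : reflexive flat_le.
Proof. by move=> X; apply/asboolP. Qed.

Fact flat_le_anti : antisymmetric flat_le.
Proof.
move=> X Y /andP[/asboolP YX /asboolP XY].
by apply: val_inj; apply/seteqP; split.
Qed.

Fact flat_le_trans : transitive flat_le.
Proof.
by move=> Y X Z /asboolP YX /asboolP ZY; apply/asboolP; apply: subset_trans YX.
Qed.

HB.instance Definition _ := Order.Le_isPOrder.Build flat_display
  (intersection_poset A) flat_le_refl flat_le_anti flat_le_trans.

Definition flat_bot : intersection_poset A := [` setT_flats A]%fset.

Fact flat_le0 X : (flat_bot <= X)%O.
Proof. by apply/asboolP => x _. Qed.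

HB.instance Definition _ := Order.hasBottom.Build flat_display
  (intersection_poset A) flat_le0.

End IntersectionPoset.

(* The linear subspace of which the affine subspace S is a translate. *)
Definition direction (R : realType) (n : nat) (S : set 'rV[R]_n) :
    {vspace 'rV[R]_n} :=
  xget 0%VS [set U : {vspace 'rV[R]_n} |
    exists p : 'rV[R]_n, S = [set x | x - p \in U]].

Definition flat_dim (R : realType) (n : nat) (A : arrangement R n)
  (X : intersection_poset A) : nat := \dim (direction (flat_set X)).

Definition flat_rank (R : realType) (n : nat) (A : arrangement R n)
  (X : intersection_poset A) : nat := (n - flat_dim X)%N.

(* mu(x, x) = 1 and mu(x, y) = - \sum_(x <= z < y) mu(x, z) for x < y; it is
   0 when x is not below y. The recursion descends along chains, so the number
   of elements of the poset is enough fuel. *)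
Fixpoint mobius_rec (d : Order.disp_t) (P : finPOrderType d) (k : nat)
    (x y : P) : int :=
  if k is k'.+1 then
    if x == y then 1
    else - \sum_(z : P | (x <= z)%O && (z < y)%O) mobius_rec k' x z
  else 0.

Definition mobius (d : Order.disp_t) (P : finPOrderType d) (x y : P) : int :=
  mobius_rec #|P| x y.

Lemma mobiusxx (d : Order.disp_t) (P : finPOrderType d) (x : P) :
  mobius x x = 1.
Proof. by rewrite /mobius (cardD1 x) inE /= eqxx. Qed.

Lemma mobius_lt (d : Order.disp_t) (P : finPOrderType d) (x y : P) :
  (x < y)%O ->
  mobius x y = - \sum_(z : P | (x <= z)%O && (z < y)%O) mobius x z.
Proof.
have fuel k l (u : P) : (#|[pred z : P | (z <= u)%O]| <= k)%N ->
    (#|[pred z : P | (z <= u)%O]| <= l)%N ->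
    mobius_rec k x u = mobius_rec l x u.
  have u_in (w : P) : (0 < #|[pred z : P | (z <= w)%O]|)%N.
    by apply/card_gt0P; exists w; rewrite inE /=.
  elim: k l u => [|k IHk] [|l] u; try by rewrite ?[(_ <= 0)%N]leqNgt u_in.
  move=> uk ul /=; case: eqP => // _; congr (- _).
  apply: eq_bigr => z /andP[_ zu].
  have card_lt : (#|[pred w : P | (w <= z)%O]|
                  < #|[pred w : P | (w <= u)%O]|)%N.
    apply: proper_card; apply/fintype.properP; split.
      by apply/fintype.subsetP => w; rewrite !inE => /le_trans; apply; apply: ltW.
    by exists u; rewrite !inE ?lexx // lt_geF.
  by apply: IHk; rewrite -ltnS; apply: leq_trans card_lt _.
move=> xy; have P_gt0 : (0 < #|P|)%N by apply/card_gt0P; exists x.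
rewrite {1}/mobius -(prednK P_gt0) /= lt_eqF //=; congr (- _).
apply: eq_bigr => z /andP[_ zy]; apply: fuel; last by apply: max_card.
rewrite -ltnS prednK //; apply: proper_card; apply/fintype.properP; split.
  by apply/fintype.subsetP.
by exists y; rewrite ?inE // lt_geF.
Qed.

Definition characteristic_poly (R : realType) (n : nat) (A : arrangement R n) :
    {poly int} :=
  \sum_(X : intersection_poset A)
     mobius (\bot%O : intersection_poset A) X *: 'X^(n - flat_rank X).

Definition shi_hyperplane (R : realType) (n : nat) (i j : 'I_n) (c : R) :
    set 'rV[R]_n :=
  [set x : 'rV[R]_n | x 0 i - x 0 j = c].

Definition shi_hyperplanes (R : realType) (n : nat) : {fset set 'rV[R]_n} :=
  let lt_pairs := [pred p : 'I_n * 'I_n | (p.1 < p.2)%N] in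
  ([fset shi_hyperplane p.1 p.2 0 | p in lt_pairs] `|`
   [fset shi_hyperplane p.1 p.2 1 | p in lt_pairs])%fset.

Lemma shi_hyperplanesP (R : realType) (n : nat) (H : set 'rV[R]_n) :
  H \in shi_hyperplanes R n -> is_hyperplane H.
Proof.
have P (i j : 'I_n) (c : R) : (i < j)%N -> is_hyperplane (shi_hyperplane i j c).
  move=> ij; exists (delta_mx 0 i - delta_mx 0 j), c; split.
    apply/eqP => /rowP/(_ i)/eqP; rewrite !mxE !eqxx /=.
    by rewrite -val_eqE /= ltn_eqF // subr0 oner_eq0.
  have sum_delta (k : 'I_n) (x : 'rV[R]_n) :
      \sum_(l < n) (l == k)%:R * x 0 l = x 0 k.
    under eq_bigr do rewrite mulr_natl mulrb.
    by rewrite -big_mkcond big_pred1_eq.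
  rewrite /shi_hyperplane; congr mkset; apply: funext => x; congr (_ = c).
  under [RHS]eq_bigr do rewrite !mxE eqxx /= mulrBl.
  by rewrite sumrB !sum_delta.
rewrite inE => /orP[] /imfsetP[[i j]] /=; rewrite inE /= => ij ->; exact: P.
Qed.

Definition shi (R : realType) (n : nat) : arrangement R n :=
  Arrangement (@shi_hyperplanesP R n).

Section FormalPowerSeries.
Variable K : comUnitRingType.

(* A series is its sequence of coefficients. *)
Definition fps := nat -> K.

Implicit Types F G : fps.

Definition fps_mul F G : fps := fun n => \sum_(i < n.+1) F i * G (n - i)%N.

Definition fps_one : fps := fun n => (n == 0%N)%:R.

Definition fps_exp F (k : nat) : fps := iter k (fps_mul F) fps_one.

(* \sum_k a_k G^k for a series G without constant term, in which case G^k does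
   not contribute to the coefficients of index less than k. *)
Definition fps_comp (a : fps) G : fps :=
  fun n => \sum_(k < n.+1) a k * fps_exp G k n.

Definition fps_sub1 F : fps := fun n => F n - fps_one n.

(* 1 / F, log F and F ^ q are meant for F with constant term 1: they are the
   series of 1 / (1 + t) and log (1 + t) at t = F - 1, and exp (q log F). *)
Definition fps_inv F : fps := fps_comp (fun k => (-1) ^+ k) (fps_sub1 F).

Lemma fps_exp_eq0 F (k n : nat) : F 0%N = 0 -> (n < k)%N -> fps_exp F k n = 0.
Proof.
move=> F0; elim: k n => // k IHk n nk.
rewrite /fps_exp iterS -/(fps_exp F k) /fps_mul big1 // => -[[|i] /= lin] _.
  by rewrite F0 mul0r.
rewrite IHk ?mulr0 // ltn_subLR // addSn.
by apply: leq_trans nk _; rewrite ltnS leq_addl.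
Qed.

Lemma fps_mulV F : F 0%N = 1 -> fps_mul F (fps_inv F) = fps_one.
Proof.
move=> F0; set H := fps_sub1 F.
have H0 : H 0%N = 0 by rewrite /H /fps_sub1 /fps_one F0 subrr.
have invE m n : (n <= m)%N ->
    fps_inv F n = \sum_(k < m.+1) (-1) ^+ k * fps_exp H k n.
  move=> nm; rewrite /fps_inv /fps_comp -/H.
  rewrite -!(big_mkord xpredT (fun k => (-1) ^+ k * fps_exp H k n)).
  rewrite [RHS](@big_cat_nat _ _ _ n.+1) //= [X in _ = _ + X]big_nat_cond.
  rewrite [X in _ = _ + X]big1 ?addr0 // => k /andP[/andP[nk _] _].
  by rewrite fps_exp_eq0 ?mulr0.
apply: funext => n; rewrite /fps_mul.
have -> : \sum_(i < n.+1) F i * fps_inv F (n - i)%N =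
    fps_inv F n + \sum_(i < n.+1) H i * fps_inv F (n - i)%N.
  rewrite !big_ord_recl H0 F0 /= mul0r add0r mul1r subn0; congr (_ + _).
  by apply: eq_bigr => i _; rewrite /H /fps_sub1 /fps_one subr0.
have -> : \sum_(i < n.+1) H i * fps_inv F (n - i)%N =
    \sum_(k < n.+1) (-1) ^+ k * fps_exp H k.+1 n.
  under eq_bigr => i _ do rewrite (@invE n) ?leq_subr // mulr_sumr.
  rewrite exchange_big; apply: eq_bigr => k _; rewrite mulr_sumr.
  by apply: eq_bigr => i _; rewrite mulrCA.
rewrite (@invE n.+1) // big_ord_recl /= expr0 mul1r -addrA -big_split /=.
rewrite big1 ?addr0 // => k _.
by rewrite /bump /= add1n exprS mulN1r mulNr addNr.
Qed.

Definition fps_div F G : fps := fps_mul F (fps_inv G).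

Definition fps_log F : fps :=
  fps_comp (fun k => if k is k'.+1 then (-1) ^+ k' / k%:R else 0) (fps_sub1 F).

Definition fps_Exp G : fps := fps_comp (fun k => (k`!)%:R^-1) G.

Definition fps_pow F (q : K) : fps := fps_Exp (fun n => q * fps_log F n).

Definition fps_cvg (u : nat -> fps) F : Prop :=
  forall b : nat, \forall r \near \oo, u r b = F b.

End FormalPowerSeries.

(* q is 'X; the nonzero rational constants divided by in fps_log and fps_Exp
   are units of {poly rat}. *)
Definition fps_pow_indet (F : fps rat) : fps {poly rat} :=
  fps_pow (fun n => (F n)%:P) 'X.

Definition shi_egf (R : realType) : fps {poly rat} :=
  fun n => (n`!%:R : rat)^-1 *:
    map_poly intr (characteristic_poly (shi R n)).

(* ssrnat's 0 ^ 0 is 1, as needed for the coefficient n = r = 0. *)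
Definition A_ (r : nat) : fps rat :=
  fun n => if (n <= r)%N then ((r - n) ^ n)%N%:R / n`!%:R else 0.

(* Main.v *)
(* The finite field method evaluates the characteristic polynomial of the Shi
   arrangement: for q > n the residues p : {1..n} -> Z/q miss some place of the
   circle Z/q, and cutting the circle there turns the congruences p_i = p_j and
   p_i = p_j + 1 into the equations of the hyperplanes, so that chi(q) counts
   the p satisfying none of them for i < j. Reading off, for each label, the
   number of empty places before it shows that (q - n)^n of these p leave a
   given place empty; hence chi(q) (q - n) = q (q - n)^n.

   On the power series side put E_b = \sum_n b (b - n)^(n-1) x^n / n! and
   Q_b = \sum_n (b - n)^n x^n / n!. Abel's identity E_1 Q_b = Q_(b+1) gives
   the limit A_r / A_(r-1) --> E_1, and with E_b = Q_b + x Q_(b-1) it gives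
   E_1 E_b = E_(b+1). Thus E_m = E_1^m for every natural m, so that
   E_1 E_m' = m E_1' E_m; both sides being polynomial in m, the same holds for
   an indeterminate q, and this differential equation characterizes E_1^q. *)
From HB Require Import structures.
Require Import Defs.
From mathcomp Require Import all_boot all_order all_algebra reals.
From mathcomp Require Import finmap boolp classical_sets filter.
From mathcomp Require Import zify ring.

Set Implicit Arguments.
Unset Strict Implicit.
Unset Printing Implicit Defensive.

Import Order.TTheory GRing.Theory Num.Theory.
Local Open Scope ring_scope.

(** * Formal power series *)

Section FpsTheory.
Variable K : comUnitRingType.
Implicit Types F G H : fps K.

(** Commutativity, associativity and the Leibniz rule are inherited from [{poly K}]: coefficient n
    of a product depends only on truncations beyond n. *)
Definition fps_trunc (N : nat) F : {poly K} := \poly_(i < N) F i.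

Lemma fps_mul_trunc N F G n : (n < N)%N ->
  fps_mul F G n = (fps_trunc N F * fps_trunc N G)`_n.
Proof.
move=> nN; rewrite coefM; apply: eq_bigr => i _; rewrite !coef_poly.
by rewrite (leq_ltn_trans _ nN) ?(leq_ltn_trans (leq_subr _ _) nN) // -ltnS.
Qed.

Lemma eq_fps_mul n F F' G G' :
  (forall i, (i <= n)%N -> F i = F' i) ->
  (forall i, (i <= n)%N -> G i = G' i) ->
  fps_mul F G n = fps_mul F' G' n.
Proof.
by move=> FF' GG'; apply: eq_bigr => i _; rewrite FF' ?GG' ?leq_subr // -ltnS.
Qed.

Lemma fps_mulC F G : fps_mul F G = fps_mul G F.
Proof. by apply: funext => n; rewrite !(@fps_mul_trunc n.+1) // mulrC. Qed.

Lemma fps_mulA F G H : fps_mul F (fps_mul G H) = fps_mul (fps_mul F G) H.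
Proof.
have truncM N F1 G1 i : (i < N)%N ->
    (fps_trunc N (fps_mul F1 G1))`_i = (fps_trunc N F1 * fps_trunc N G1)`_i.
  by move=> iN; rewrite coef_poly iN (@fps_mul_trunc N).
apply: funext => n; rewrite !(@fps_mul_trunc n.+1) //.
transitivity ((fps_trunc n.+1 F * fps_trunc n.+1 G * fps_trunc n.+1 H)`_n).
  rewrite -mulrA !coefM; apply: eq_bigr => i _.
  by rewrite truncM // ltnS leq_subr.
by rewrite !coefM; apply: eq_bigr => i _; rewrite truncM.
Qed.

Lemma fps_mul1 F : fps_mul F (@fps_one K) = F.
Proof.
apply: funext => n; rewrite /fps_mul big_ord_recr /= subnn /fps_one mulr1.
by rewrite big1 ?add0r // => i _; rewrite subn_eq0 leqNgt ltn_ord mulr0.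
Qed.

Lemma fps_mul1l F : fps_mul (@fps_one K) F = F.
Proof. by rewrite fps_mulC fps_mul1. Qed.

Lemma fps_mul_scaler F G a n :
  fps_mul F (fun i => a * G i) n = a * fps_mul F G n.
Proof. by rewrite mulr_sumr; apply: eq_bigr => i _; rewrite mulrCA. Qed.

Lemma fps_mul_scalel F G a n :
  fps_mul (fun i => a * F i) G n = a * fps_mul F G n.
Proof. by rewrite fps_mulC fps_mul_scaler fps_mulC. Qed.

Lemma fps_mul_sumr (I : Type) (r : seq I) F (G : I -> fps K) n :
  fps_mul F (fun i => \sum_(k <- r) G k i) n = \sum_(k <- r) fps_mul F (G k) n.
Proof.
rewrite /fps_mul exchange_big; apply: eq_bigr => i _; exact: mulr_sumr.
Qed.

Lemma fps_expS F k : fps_exp F k.+1 = fps_mul F (fps_exp F k).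
Proof. by []. Qed.

Definition fps_deriv F : fps K := fun n => n.+1%:R * F n.+1.

Lemma fps_deriv_mul F G n : fps_deriv (fps_mul F G) n =
  fps_mul (fps_deriv F) G n + fps_mul F (fps_deriv G) n.
Proof.
have truncD N H i : (fps_trunc N.+1 H)^`()`_i = (fps_trunc N (fps_deriv H))`_i.
  rewrite coef_deriv !coef_poly ltnS -mulr_natl; case: ifP; by rewrite ?mulr0.
rewrite {1}/fps_deriv (@fps_mul_trunc n.+2) // mulr_natl -coef_deriv derivM.
rewrite coefD !coefM; congr (_ + _); apply: eq_bigr => i _.
  by rewrite truncD !coef_poly ltn_ord ltnS (leq_trans (leq_subr _ _)).
by rewrite truncD !coef_poly (ltnS (n - i)) leq_subr ltnW // ltnS.
Qed.

Lemma fps_deriv_exp F k n : fps_deriv (fps_exp F k.+1) n =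
  k.+1%:R * fps_mul (fps_exp F k) (fps_deriv F) n.
Proof.
elim: k n => [|k IHk] n.
  by rewrite mul1r fps_mul1l fps_expS fps_mul1.
rewrite fps_expS fps_deriv_mul fps_mulC.
have -> : fps_deriv (fps_exp F k.+1) =
    (fun i => k.+1%:R * fps_mul (fps_exp F k) (fps_deriv F) i).
  exact: funext.
by rewrite fps_mul_scaler fps_mulA -fps_expS [in RHS]mulrS mulrDl mul1r.
Qed.

(** Powers of G beyond the n-th do not reach degree n, so one bound N serves all n up to N, as the
    interchange of sums in the chain rule requires. *)
Lemma fps_compE N a G n : G 0%N = 0 -> (n <= N)%N ->
  fps_comp a G n = \sum_(k < N.+1) a k * fps_exp G k n.
Proof.
move=> G0 nN; rewrite /fps_comp.
rewrite (big_ord_widen N.+1 (fun k => a k * fps_exp G k n)) ?ltnS // big_mkcond.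
apply: eq_bigr => k _; case: ifP => // /negbT; rewrite -leqNgt => nk.
by rewrite fps_exp_eq0 ?mulr0.
Qed.

Lemma fps_deriv_comp a G n : G 0%N = 0 -> fps_deriv (fps_comp a G) n =
  fps_mul (fps_deriv G) (fps_comp (fps_deriv a) G) n.
Proof.
move=> G0; rewrite {1}/fps_deriv (@fps_compE n.+1) // mulr_sumr big_ord_recl.
rewrite /= mulr0 mulr0 add0r.
transitivity (fps_mul (fps_deriv G)
   (fun i => \sum_(k < n.+1) fps_deriv a k * fps_exp G k i) n); last first.
  by apply: eq_fps_mul => // i le_in; rewrite (@fps_compE n).
rewrite fps_mul_sumr; apply: eq_bigr => k _; rewrite /bump /= add1n.
rewrite mulrCA -[_ * fps_mul _ _ _]/(fps_deriv (fps_exp G k.+1) n).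
rewrite fps_deriv_exp fps_mul_scaler mulrA [a _ * _]mulrC.
by congr (_ * _); rewrite fps_mulC.
Qed.

Lemma fps_comp0 a G : fps_comp a G 0%N = a 0%N.
Proof. by rewrite /fps_comp big_ord1 /= /fps_one mulr1. Qed.

Lemma fps_sub10 F : F 0%N = 1 -> fps_sub1 F 0%N = 0.
Proof. by rewrite /fps_sub1 /fps_one => ->; rewrite subrr. Qed.

(** Multiplying by 1 / G cancels G, and coefficient m of a product only sees degrees up to m. The
    bound matters because the relation between consecutive [A_] is available in low degrees only. *)
Lemma fps_divP m F G H : G 0%N = 1 ->
  (forall i, (i <= m)%N -> fps_mul H G i = F i) -> fps_div F G m = H m.
Proof.
move=> G0 HG; rewrite -[H]fps_mul1 -(fps_mulV G0) fps_mulA.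
by apply: eq_fps_mul => // i im; rewrite HG.
Qed.

Hypothesis natU : forall n, (n.+1%:R : K) \is a GRing.unit.

Lemma fps_log0 F : fps_log F 0%N = 0.
Proof. exact: fps_comp0. Qed.

Lemma fps_deriv_log F n : F 0%N = 1 ->
  fps_deriv (fps_log F) n = fps_mul (fps_deriv F) (fps_inv F) n.
Proof.
move=> F0; rewrite fps_deriv_comp ?fps_sub10 //.
have -> : fps_deriv (fps_sub1 F) = fps_deriv F.
  by apply: funext => k; rewrite /fps_deriv /fps_sub1 /fps_one subr0.
(* The termwise derivative of log (1 + t) is the geometric series that defines [fps_inv]. *)
congr (fps_mul _ (fps_comp _ _) _); apply: funext => k.
by rewrite /fps_deriv mulrC divrK.
Qed.

Lemma fps_deriv_Exp G n : G 0%N = 0 ->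
  fps_deriv (fps_Exp G) n = fps_mul (fps_deriv G) (fps_Exp G) n.
Proof.
move=> G0; rewrite fps_deriv_comp //.
congr (fps_mul _ (fps_comp _ _) _); apply: funext => k.
have factU j : (j`!%:R : K) \is a GRing.unit.
  by elim: j => [|j IHj]; rewrite ?unitr1 // factS natrM unitrM natU.
by rewrite /fps_deriv factS natrM invrM // mulrCA divrr // mulr1.
Qed.

Lemma fps_pow0 F q : fps_pow F q 0%N = 1.
Proof. by rewrite /fps_pow /fps_Exp fps_comp0 invr1. Qed.

Lemma fps_deriv_pow F q n : F 0%N = 1 ->
  fps_mul F (fps_deriv (fps_pow F q)) n =
  q * fps_mul (fps_deriv F) (fps_pow F q) n.
Proof.
move=> F0; set L := fun i => q * fps_log F i.
have L0 : L 0%N = 0 by rewrite /L fps_log0 mulr0.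
have -> : fps_deriv (fps_pow F q) = fps_mul (fps_deriv L) (fps_pow F q).
  by apply: funext => i; rewrite fps_deriv_Exp.
have -> : fps_deriv L = fun i => q * fps_mul (fps_deriv F) (fps_inv F) i.
  by apply: funext => i; rewrite -fps_deriv_log // /fps_deriv /L mulrCA.
rewrite fps_mulA -fps_mul_scalel; apply: eq_fps_mul => // i _.
rewrite fps_mul_scaler fps_mulC -fps_mulA [fps_mul _ F]fps_mulC.
by rewrite fps_mulV // fps_mul1.
Qed.

(** Both series satisfy the same differential equation, and its coefficient n determines coefficient
    n + 1 of the solution from the earlier ones: F has constant term 1 and n + 1 is a unit. *)
Lemma fps_powP F q E : F 0%N = 1 -> E 0%N = 1 ->
  (forall n, fps_mul F (fps_deriv E) n = q * fps_mul (fps_deriv F) E n) ->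
  E = fps_pow F q.
Proof.
move=> F0 E0 EF; apply: funext => n.
elim/ltn_ind: n => -[|n] IHn; first by rewrite E0 fps_pow0.
have := EF n; have := fps_deriv_pow q n F0.
have -> : fps_mul (fps_deriv F) (fps_pow F q) n = fps_mul (fps_deriv F) E n.
  by apply: eq_fps_mul => // i le_in; rewrite IHn.
(* Only the summand i = 0 involves coefficient n + 1 of the unknown series. *)
move=> <-; rewrite /fps_mul !big_ord_recl F0 !mul1r subn0.
have -> : \sum_(i < n) F (lift ord0 i) * fps_deriv E (n - lift ord0 i)%N =
   \sum_(i < n) F (lift ord0 i) * fps_deriv (fps_pow F q) (n - lift ord0 i)%N.
  apply: eq_bigr => i _; rewrite /fps_deriv IHn //.
  by rewrite ltnS lift0 ltn_subrL (leq_trans _ (ltn_ord i)).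
by move/addIr/(mulrI (natU n)).
Qed.

End FpsTheory.

(** * Abel's identity *)

Lemma eq_poly_nat (K : idomainType) (N : nat) (p q : {poly K}) :
  (forall m n : nat, m%:R = n%:R :> K -> m = n) ->
  (forall m : nat, (N <= m)%N -> p.[m%:R] = q.[m%:R]) -> p = q.
Proof.
move=> natI pq; apply/eqP; rewrite -subr_eq0.
apply: contraT => pq0.
pose s := [seq (i%:R : K) | i <- iota N (size (p - q))].
have s_roots : all (root (p - q)) s.
  apply/allP => x /mapP[i]; rewrite mem_iota => /andP[Ni _] ->.
  by rewrite /root hornerD hornerN pq // subrr.
have s_uniq : uniq s by rewrite map_inj_uniq ?iota_uniq // => i j /natI.
by have := max_poly_roots pq0 s_roots s_uniq; rewrite size_map size_iota ltnn.
Qed.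

(** An n-th finite difference kills polynomials of degree below n. In the induction on j, one factor
    k + c is split: c keeps n, while k is absorbed into the binomial, lowering n and raising c by
    1. *)
Lemma alternating_sum_exp (K : comNzRingType) (n j : nat) (c : K) : (j < n)%N ->
  \sum_(k < n.+1) (-1) ^+ k * 'C(n, k)%:R * (k%:R + c) ^+ j = 0.
Proof.
elim: j n c => [|j IHj] n c jn.
  have := exprDn (1 : K) (-1) n.
  rewrite subrr expr0n gtn_eqF // => /esym; congr (_ = _).
  apply: eq_bigr => k _; rewrite expr1n mul1r expr0 mulr1 -mulr_natr.
  by [].
case: n jn => // n jn.
have -> : \sum_(k < n.+2) (-1) ^+ k * 'C(n.+1, k)%:R * (k%:R + c) ^+ j.+1 =
   c * \sum_(k < n.+2) (-1) ^+ k * 'C(n.+1, k)%:R * (k%:R + c) ^+ j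
   - n.+1%:R * \sum_(k < n.+1) (-1) ^+ k * 'C(n, k)%:R * (k%:R + (c + 1)) ^+ j.
  rewrite mulr_sumr mulr_sumr.
  under eq_bigr => k _ do rewrite exprS mulrA mulrDr mulrDl.
  rewrite big_split /= addrC; congr (_ + _).
    by apply: eq_bigr => k _; ring.
  rewrite big_ord_recl /= mulr0 mul0r add0r -sumrN; apply: eq_bigr => k _.
  rewrite /bump /= add1n.
  have -> : k.+1%:R + c = k%:R + (c + 1) by rewrite -addn1 natrD; ring.
  have binE : k.+1%:R * 'C(n.+1, k.+1)%:R = n.+1%:R * 'C(n, k)%:R :> K.
    by rewrite -!natrM -mul_bin_diag.
  have -> : (-1) ^+ k.+1 * 'C(n.+1, k.+1)%:R * k.+1%:R =
            - (-1) ^+ k * (k.+1%:R * 'C(n.+1, k.+1)%:R) :> K.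
    by rewrite exprS; ring.
  by rewrite binE; ring.
by rewrite !IHj // ?mulr0 ?subrr // ltnW.
Qed.

Lemma eq_poly_deriv (p q : {poly rat}) (c : rat) :
  p^`() = q^`() -> p.[c] = q.[c] -> p = q.
Proof.
move=> pq' pqc; apply/eqP; rewrite -subr_eq0; apply/eqP.
have d0 : (p - q)^`() = 0 by rewrite derivB pq' subrr.
have pqE : p - q = ((p - q)`_0)%:P.
  apply/polyP => -[|i]; rewrite coefC //=.
  have /eqP := congr1 (fun r : {poly rat} => r`_i) d0.
  by rewrite coef0 coef_deriv mulrn_eq0 /= => /eqP.
have := congr1 (fun r : {poly rat} => r.[c]) pqE.
by rewrite hornerD hornerN pqc subrr hornerC => pq0; rewrite pqE -pq0.
Qed.

(** Coefficients of E_b and Q_b as polynomials in b, so that b may later be an indeterminate. The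
    case n = 0 of E_b, with formal exponent -1, is set to 1. *)
Definition abel_poly (n : nat) : {poly rat} :=
  if n is m.+1 then n`!%:R^-1 *: ('X * ('X - n%:R%:P) ^+ m) else 1.

Definition abel_shift (n : nat) : {poly rat} :=
  n`!%:R^-1 *: ('X - n%:R%:P) ^+ n.

Lemma natr_neq0 n : n.+1%:R != 0 :> rat.
Proof. by rewrite pnatr_eq0. Qed.

Lemma fact_neq0 n : n`!%:R != 0 :> rat.
Proof. by rewrite pnatr_eq0 -lt0n fact_gt0. Qed.

Lemma deriv_abel_shift n :
  (abel_shift n.+1)^`() = abel_shift n \Po ('X - 1).
Proof.
rewrite /abel_shift derivZ deriv_exp derivB derivX derivC subr0 mul1r.
rewrite comp_polyZ rmorphXn /= comp_polyB comp_polyX comp_polyC.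
rewrite -scaler_nat scalerA; congr (_ *: _ ^+ n).
  by rewrite factS natrM invfM mulrAC mulVf ?mul1r // natr_neq0.
by rewrite -addn1 natrD polyCD opprD addrA addrAC.
Qed.

(** Induction on n: by [deriv_abel_shift] and the previous case the two sides have equal
    derivatives, so comparing them at one point suffices. *)
Lemma abel_identity n :
  \sum_(k < n.+1) (abel_poly k).[1] *: abel_shift (n - k) =
  abel_shift n \Po ('X + 1).
Proof.
elim: n => [|n IHn].
  rewrite big_ord1 /abel_shift /= !expr0 hornerC scale1r comp_polyZ.
  by rewrite -[X in _ = _ *: (X \Po _)]polyC1 comp_polyC.
(* In degree n + 1 the right side vanishes at n. *)
apply: (@eq_poly_deriv _ _ n%:R).
  rewrite deriv_comp deriv_abel_shift derivD derivX derivC addr0 mulr1.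
  rewrite -comp_polyA comp_polyB comp_polyX comp_polyC addrK comp_polyXr.
  rewrite raddf_sum big_ord_recr /= subnn derivZ /abel_shift expr0.
  rewrite alg_polyC derivC scaler0 addr0.
  transitivity ((\sum_(k < n.+1) (abel_poly k).[1] *: abel_shift (n - k))
     \Po ('X - 1)).
    rewrite raddf_sum; apply: eq_bigr => k _ /=.
    by rewrite derivZ comp_polyZ -deriv_abel_shift subSn // -ltnS.
  rewrite IHn -comp_polyA comp_polyD comp_polyX comp_polyC subrK.
  by rewrite comp_polyXr.
have shiftE j (x : rat) : (abel_shift j).[x] = j`!%:R^-1 * (x - j%:R) ^+ j.
  by rewrite /abel_shift !hornerE.
rewrite horner_sum horner_comp shiftE !hornerE -[n.+1]addn1 natrD subrr.
rewrite addn1 expr0n mulr0.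
(* At n, the powers of 1 - k and k - 1 in term k combine, up to sign, to the n-th power of k - 1: an
   (n+1)-st difference of a polynomial of degree n. *)
transitivity (- n.+1`!%:R^-1 * \sum_(k < n.+2)
    (-1) ^+ k * 'C(n.+1, k)%:R * (k%:R + (- 1 : rat)) ^+ n); last first.
  by rewrite alternating_sum_exp ?mulr0.
rewrite mulr_sumr; apply: eq_bigr => -[k /= kn] _.
rewrite hornerZ shiftE.
have -> : n%:R - (n.+1 - k)%:R = k%:R - 1 :> rat.
  by rewrite natrB // -[n.+1]addn1 natrD; ring.
have -> : 'C(n.+1, k)%:R = n.+1`!%:R / (k`!%:R * (n.+1 - k)`!%:R) :> rat.
  rewrite -(bin_fact (kn : k <= n.+1)%N) !natrM mulfK //.
  by rewrite mulf_neq0 ?fact_neq0.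
case: k kn => [|k] kn.
  rewrite subn0 fact0 hornerC exprS sub0r expr0; field.
  by rewrite ?fact_neq0.
rewrite /= hornerZ hornerM hornerX mul1r horner_exp hornerD hornerN.
rewrite hornerX hornerC subSS.
have -> : (1 - k.+1%:R : rat) = - k%:R by rewrite -addn1 natrD; ring.
have -> : (k.+1%:R - 1 : rat) = k%:R by rewrite -addn1 natrD; ring.
have -> : (k%:R : rat) ^+ n = k%:R ^+ k * k%:R ^+ (n - k).
  by rewrite -exprD subnKC.
rewrite [(- k%:R) ^+ k]exprNn exprS; field.
by rewrite !fact_neq0.
Qed.

(** * The series E_b and Q_b *)

Definition abel_series (b : rat) : fps rat := fun n => (abel_poly n).[b].

Definition abel_shift_series (b : rat) : fps rat := fun n => (abel_shift n).[b].

Lemma abel_shiftE b n :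
  abel_shift_series b n = n`!%:R^-1 * (b - n%:R) ^+ n.
Proof.
rewrite /abel_shift_series hornerZ horner_exp hornerD hornerN hornerX.
by rewrite hornerC.
Qed.

Lemma abel_seriesS b n :
  abel_series b n.+1 = n.+1`!%:R^-1 * (b * (b - n.+1%:R) ^+ n).
Proof.
rewrite /abel_series /= hornerZ hornerM horner_exp hornerD hornerN hornerX.
by rewrite hornerC.
Qed.

(** This is E_b = Q_b + x Q_(b-1): write the factor b as (b - N) + N with N = n + 1, and cancel N
    against the factorial. *)
Lemma abel_series_shift b n : abel_series b n.+1 =
  abel_shift_series b n.+1 + abel_shift_series (b - 1) n.
Proof.
rewrite abel_seriesS !abel_shiftE exprS factS natrM.
have -> : b - 1 - n%:R = b - n.+1%:R by rewrite -addn1 natrD; ring.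
by move: n.+1%:R (natr_neq0 n) => N N0; field; rewrite N0 fact_neq0.
Qed.

Lemma mul_abel_shift b :
  fps_mul (abel_series 1) (abel_shift_series b) = abel_shift_series (b + 1).
Proof.
apply: funext => n.
have := congr1 (fun p : {poly rat} => p.[b]) (abel_identity n).
rewrite /= horner_sum horner_comp hornerD hornerX hornerC => abelE.
rewrite [RHS]/abel_shift_series -abelE.
by apply: eq_bigr => k _; rewrite hornerZ.
Qed.

(** Multiply E_b = Q_b + x Q_(b-1) by E_1 and apply [mul_abel_shift] to both terms. *)
Lemma mul_abel b :
  fps_mul (abel_series 1) (abel_series b) = abel_series (b + 1).
Proof.
apply: funext => -[|n].
  by rewrite /fps_mul big_ord1 /abel_series /= !hornerC mulr1.
rewrite abel_series_shift -mul_abel_shift addrAC -mul_abel_shift.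
rewrite /fps_mul big_ord_recr [X in X + _ = _]/= subnn.
rewrite [X in _ = X + _]big_ord_recr [X in _ = X + _ + _]/= subnn addrAC.
have -> : abel_series b 0 = abel_shift_series b 0.
  by rewrite abel_shiftE expr0 invr1 mulr1 /abel_series hornerC.
congr (_ + _); rewrite -big_split; apply: eq_bigr => k _.
have kn : (k <= n)%N by rewrite -ltnS.
by rewrite /= subSn // abel_series_shift mulrDr.
Qed.

Lemma abel_series0 : abel_series 0 = @fps_one rat.
Proof.
apply: funext => -[|n]; rewrite ?abel_seriesS ?mul0r ?mulr0 //.
by rewrite /abel_series hornerC.
Qed.

Lemma abel_series_nat m : abel_series m%:R = fps_exp (abel_series 1) m.
Proof.
elim: m => [|m IHm]; first exact: abel_series0.
by rewrite fps_expS -IHm mul_abel -[m.+1]addn1 natrD.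
Qed.

(** Each coefficient of the equation in [fps_powP] is polynomial in q, so it is checked at every
    natural m, where E_m is the m-th power of E_1. *)
Lemma abel_series_indet : abel_poly = fps_pow_indet (abel_series 1).
Proof.
have natU (n : nat) : (n.+1%:R : {poly rat}) \is a GRing.unit.
  by rewrite -polyC_natr rmorph_unit // unitfE natr_neq0.
apply: (fps_powP natU) => //; first by rewrite /abel_series hornerC.
move=> n; apply: (@eq_poly_nat _ 0) => [i j /eqP|m _].
  by rewrite eqr_nat => /eqP.
rewrite hornerM hornerX !horner_sum.
transitivity (fps_mul (abel_series 1) (fps_deriv (abel_series m%:R)) n).
  apply: eq_bigr => i _; rewrite hornerM hornerC; congr (_ * _).
  by rewrite /fps_deriv hornerM -polyC_natr hornerC.
transitivity (m%:R * fps_mul (fps_deriv (abel_series 1)) (abel_series m%:R) n);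
  last first.
  congr (_ * _); apply: eq_bigr => i _; rewrite hornerM; congr (_ * _).
  by rewrite /fps_deriv hornerM -polyC_natr !hornerC.
case: m => [|m].
  rewrite mul0r abel_series0 /fps_mul big1 // => i _.
  by rewrite /fps_deriv /fps_one !mulr0.
rewrite {1}abel_series_nat.
have -> : fps_deriv (fps_exp (abel_series 1) m.+1) = (fun i => m.+1%:R *
    fps_mul (fps_exp (abel_series 1) m) (fps_deriv (abel_series 1)) i).
  by apply: funext => i; rewrite fps_deriv_exp.
rewrite fps_mul_scaler fps_mulA -fps_expS -abel_series_nat.
by rewrite fps_mulC.
Qed.

(** * Limits of the quotients of consecutive [A_] *)

Lemma A_E r n : (n <= r)%N -> A_ r n = abel_shift_series r%:R n.
Proof. by move=> nr; rewrite /A_ nr abel_shiftE natrX natrB // mulrC. Qed.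

Lemma mul_abel_A r n : (n <= r)%N ->
  fps_mul (abel_series 1) (A_ r) n = A_ r.+1 n.
Proof.
move=> nr; rewrite A_E ?(leqW nr) // -[r.+1]addn1 natrD -mul_abel_shift.
by apply: eq_fps_mul => // i le_in; rewrite A_E ?(leq_trans le_in).
Qed.

Lemma A_0 r : A_ r 0 = 1.
Proof. by rewrite A_E // abel_shiftE expr0 invr1 mulr1. Qed.

Lemma cvg_A_div : fps_cvg (fun r => fps_div (A_ r) (A_ r.-1)) (abel_series 1).
Proof.
(* From r = b + 1 on, r - 1 is at least b, so the recurrence for [A_] holds in all degrees up to
   b. *)
move=> b; exists b.+1 => // -[|r] //= br.
apply: fps_divP => [|i ib]; first exact: A_0.
by rewrite mul_abel_A // (leq_trans ib).
Qed.

(** Since E_(-1) E_1 = E_0 = 1, multiplying E_1 A_(r-1) = A_r by E_(-1) gives back A_(r-1) in low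
    degrees. *)
Lemma cvg_A_div_inv :
  fps_cvg (fun r => fps_div (A_ r.-1) (A_ r)) (abel_series (- 1)).
Proof.
move=> b; exists b.+1 => // -[|r] //= br.
apply: fps_divP => [|i ib]; first exact: A_0.
transitivity (fps_mul (abel_series (-1)) (fps_mul (abel_series 1) (A_ r)) i).
  apply: eq_fps_mul => // j ji.
  by rewrite mul_abel_A // (leq_trans ji) ?(leq_trans ib).
rewrite fps_mulA [fps_mul (abel_series (-1)) _]fps_mulC mul_abel addNr.
by rewrite abel_series0 fps_mul1l.
Qed.

Lemma abel_seriesN1 n : abel_series (- 1) n =
  (-1) ^+ n * (n.+1%:R : rat) ^ (n%:Z - 1) / n`!%:R.
Proof.
(* At n = 0 the exponent is -1, but the base is 1. *)
case: n => [|n]; first by rewrite /abel_series hornerC exp1rz divr1 mulr1.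
rewrite abel_seriesS -[n.+1%:Z - 1]/(n.+1%:Z - 1%:Z) subzn // subn1 /=.
have -> : -1 - n.+1%:R = - n.+2%:R :> rat by rewrite -[n.+2]addn1 natrD; ring.
by rewrite [(- _) ^+ n]exprNn exprS -exprnP; ring.
Qed.

(** * Shi-avoiding placements on a circle *)

Section ShiPlacements.
Variables n m : nat.
Implicit Types (p : {ffun 'I_n -> 'I_m.+2}) (e : 'I_m.+2).

(** Places form the ring Z/(m+2), so [p j + 1] wraps around the circle. *)
Definition shi_valid p :=
  [forall i : 'I_n, forall j : 'I_n,
     (i < j)%N ==> (p i != p j) && (p i != p j + 1)].

Definition avoids p e := [forall i, p i != e].

Lemma shi_validP p : reflect
  (forall i j : 'I_n, (i < j)%N -> p i != p j /\ p i != p j + 1) (shi_valid p).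
Proof.
apply: (iffP forallP) => [v i j ij|v i].
  by have /forallP/(_ j)/implyP/(_ ij)/andP := v i.
by apply/forallP => j; apply/implyP => /v[-> ->].
Qed.

Lemma shi_valid_inj p : shi_valid p -> injective p.
Proof.
move=> /shi_validP v i j pij; apply/val_inj/eqP; case: ltngtP => // ij.
  by case: (v _ _ ij); rewrite pij eqxx.
by case: (v _ _ ij); rewrite pij eqxx.
Qed.

Lemma val_Zp_add1 e : val (e + 1) = if val e == m.+1 then 0%N else (val e).+1.
Proof.
have := ltn_ord e; rewrite /= modnDmr => em.
case: eqP => [->|/eqP ne]; first by rewrite addn1 modnn.
by rewrite addn1 modn_small // ltnS ltn_neqAle ne -ltnS.
Qed.

(** * From gap functions to placements *)

Section Gaps.
Variable (k : nat) (f : 'I_n -> 'I_k).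

(** The order of the labels along the circle from place 0: by gap, and increasingly within a gap,
    since a larger label just before a smaller one is forbidden. *)
Definition gap_lt (j i : 'I_n) := (f j < f i)%N || ((f j == f i) && (j < i)%N).

Definition gap_rank (i : 'I_n) := #|[set j | gap_lt j i]|.

(* The label i sits after f i + 1 empty places (counting the place 0) and after
   the labels in earlier gaps or smaller labels in its own gap. *)
Definition gap_pos (i : 'I_n) := (f i + gap_rank i).+1.

Lemma gap_lt_trans : transitive gap_lt.
Proof. rewrite /gap_lt => j i l; rewrite -!val_eqE /=; lia. Qed.

Lemma gap_ltxx i : gap_lt i i = false.
Proof. rewrite /gap_lt eqxx; lia. Qed.

Lemma gap_lt_total i j : i != j -> gap_lt i j || gap_lt j i.
Proof. rewrite /gap_lt -!val_eqE /=; lia. Qed.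

Lemma gap_rank_lt i j : gap_lt i j -> (gap_rank i < gap_rank j)%N.
Proof.
move=> ij; apply/proper_card/fintype.properP; split.
  by apply/fintype.subsetP => l; rewrite !inE => /gap_lt_trans; apply.
by exists i; rewrite !inE ?gap_ltxx.
Qed.

Lemma gap_pos_ltE i j : (gap_pos i < gap_pos j)%N = gap_lt i j.
Proof.
have lt_pos a b : gap_lt a b -> (gap_pos a < gap_pos b)%N.
  move=> ab; have := gap_rank_lt ab; move: ab.
  by rewrite /gap_lt /gap_pos -val_eqE /=; lia.
apply/idP/idP; last exact: lt_pos.
case: (eqVneq i j) => [->|/gap_lt_total/orP[]//]; first by rewrite ltnn.
by move=> /lt_pos; lia.
Qed.

Lemma gap_rank_max i : (gap_rank i < n)%N.
Proof.
rewrite -[X in (_ < X)%N]card_ord -cardsT; apply/proper_card/fintype.properP.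
split; first by apply/fintype.subsetP => j; rewrite inE.
by exists i; rewrite !inE ?gap_ltxx.
Qed.

End Gaps.

Definition place (k : nat) (f : {ffun 'I_n -> 'I_k}) : {ffun 'I_n -> 'I_m.+2} :=
  [ffun i => inord (gap_pos f i)].

(** Here k is the number of empty places. The largest possible position is (k - 1) + (n - 1) + 1 = m
    + 1, so [inord] does not alter it. *)
Lemma val_place k (f : {ffun 'I_n -> 'I_k}) i : (n + k = m.+2)%N ->
  place f i = gap_pos f i :> nat.
Proof.
move=> nk; rewrite ffunE inordK //.
by have := gap_rank_max f i; have := ltn_ord (f i); rewrite /gap_pos; lia.
Qed.

(** Positions determine the order [gap_lt], hence the ranks; subtracting these recovers f. *)
Lemma place_inj k : (n + k = m.+2)%N -> injective (@place k).
Proof.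
move=> nk f g fg; apply/ffunP => i; apply: val_inj => /=.
have fgE j : gap_pos f j = gap_pos g j by rewrite -!val_place // fg.
have rankE : gap_rank f i = gap_rank g i.
  by apply: eq_card => j; rewrite !inE -!gap_pos_ltE !fgE.
by have := fgE i; rewrite /gap_pos rankE; lia.
Qed.

Lemma place_valid k (f : {ffun 'I_n -> 'I_k}) : (n + k = m.+2)%N ->
  shi_valid (place f) && avoids (place f) 0.
Proof.
move=> nk; apply/andP; split; last first.
  by apply/forallP => i; rewrite -val_eqE /= val_place.
apply/shi_validP => i j ij; rewrite -!val_eqE val_Zp_add1 /= !val_place //.
have ne : gap_lt f i j || gap_lt f j i.
  by apply: gap_lt_total; rewrite -val_eqE /= neq_ltn ij.
split; first by move: ne; rewrite -!gap_pos_ltE; lia.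
(* Wrapping around would put label i on place 0, which is empty. *)
case: ifP => // _; apply/eqP => pij.
have ji : gap_lt f j i by rewrite -gap_pos_ltE pij.
(* The rank alone accounts for the step of 1, so j and i share a gap, and then j < i. *)
have := gap_rank_lt ji; move: pij ji; rewrite /gap_pos /gap_lt -val_eqE /=; lia.
Qed.

(** * From placements back to gap functions *)

Section Occupied.
Variables (p : {ffun 'I_n -> 'I_m.+2}).
Hypotheses (p_valid : shi_valid p) (p0 : avoids p 0).

Definition occupied (x : nat) := [exists i, p i == x :> nat].

(** Place 0, empty by [p0], is left out, so that the value at [p i] is the index of the gap of i,
    counted from 0. *)
Definition free_below (x : nat) := (\sum_(1 <= y < x) ~~ occupied y)%N.

Lemma occupied_below x : (0 < x)%N ->
  (\sum_(1 <= y < x) occupied y)%N = #|[set j | (p j < x)%N]|.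
Proof.
have pge1 j : (0 < p j)%N.
  by have /forallP/(_ j) := p0; rewrite -val_eqE /= lt0n.
elim: x => // -[|x] IHx _.
  by rewrite big_geq // eq_card0 // => j; rewrite !inE ltnS leqNgt pge1.
rewrite big_nat_recr //= IHx //.
have [/existsP[i /eqP pi]|/existsPn no] := boolP (occupied x.+1).
  have -> : [set j | (p j < x.+2)%N] = i |: [set j | (p j < x.+1)%N].
    apply/setP => j; rewrite !inE ltnS leq_eqVlt -pi.
    by rewrite (inj_eq val_inj) (inj_eq (shi_valid_inj p_valid)).
  by rewrite cardsU1 inE pi ltnn addnC.
rewrite addn0; apply: eq_card => j.
by rewrite !inE; have := no j; lia.
Qed.

Lemma free_below_occupied x : (0 < x)%N ->
  (free_below x + #|[set j | (p j < x)%N]|).+1 = x.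
Proof.
move=> x0; rewrite -occupied_below // -big_split /=.
under eq_bigr do rewrite addn_negb.
by rewrite sum_nat_const_nat muln1 subn1 prednK.
Qed.

Lemma free_below_le x y : (x <= y)%N -> (0 < x)%N ->
  free_below y = (free_below x + \sum_(x <= z < y) ~~ occupied z)%N.
Proof. by move=> xy x0; rewrite /free_below (@big_cat_nat _ _ _ x). Qed.

(** Labels increase along a run of occupied places: validity forces it for neighbours, and d + 1 is
    the length of the run. *)
Lemma run_lt d (i j : 'I_n) : p j = (p i + d).+1 :> nat ->
  (forall z, (p i <= z < p j)%N -> occupied z) -> (i < j)%N.
Proof.
have step a b : p b = (p a).+1 :> nat -> (a < b)%N.
  move=> ba; rewrite ltnNge leq_eqVlt; apply/negP => /orP[/eqP/val_inj ab|ab].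
    by move: ba; rewrite ab; lia.
  have /shi_validP/(_ _ _ ab)[_ /eqP] := p_valid; apply; apply: val_inj.
  by rewrite val_Zp_add1 /= ba; case: eqP => // am; have := ltn_ord (p b); lia.
elim: d j => [|d IHd] j pj occ; first by apply: step; rewrite pj addn0.
have /existsP[l /eqP pl] : occupied (p i + d).+1 by apply: occ; lia.
apply: (@ltn_trans l); first by apply: IHd => // z zl; apply: occ; lia.
by apply: step; lia.
Qed.

Lemma place_surj k : (n + k = m.+2)%N ->
  exists f : {ffun 'I_n -> 'I_k}, p = place f.
Proof.
move=> nk.
have pge1 j : (0 < p j)%N.
  by have /forallP/(_ j) := p0; rewrite -val_eqE /= lt0n.
(* Counting up to m + 2 leaves k - 1 empty places besides 0. *)
have fk i : (free_below (p i) < k)%N.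
  have := @free_below_occupied m.+2 isT.
  have -> : #|[set j | (p j < m.+2)%N]| = n.
    rewrite -[RHS]card_ord -cardsT; apply: eq_card => j.
    by rewrite !inE ltn_ord.
  by rewrite (@free_below_le (p i)) ?(ltnW (ltn_ord _)) //; lia.
pose f := [ffun i => Ordinal (fk i)]; exists f.
(* An empty place between the two labels raises the gap index; with none they share a gap and
   [run_lt] orders them. *)
have ltE i j : (p i < p j)%N -> gap_lt f i j.
  move=> ij; rewrite /gap_lt -val_eqE !ffunE /=.
  rewrite (@free_below_le (p i) (p j)) //; last lia.
  case: (posnP (\sum_(p i <= z < p j) ~~ occupied z)) => [z0|]; last lia.
  rewrite z0 addn0 eqxx ltnn /=; apply: (@run_lt (p j - (p i).+1)); first lia.
  move=> z zij; case occz: (occupied z) => //; move: z0 => /eqP.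
  rewrite sum_nat_seq_eq0 => /allP/(_ z).
  by rewrite mem_index_iota zij occz => /(_ isT).
apply/ffunP => i; apply: val_inj; rewrite /= val_place // /gap_pos.
rewrite -[LHS]free_below_occupied // ffunE /=; congr (_ + _).+1.
apply: eq_card => j; rewrite !inE; apply/idP/idP => [/ltE //|ji].
rewrite ltnNge leq_eqVlt; apply/negP => /orP[].
  move=> /eqP/val_inj/(shi_valid_inj p_valid) ij.
  by move: ji; rewrite ij gap_ltxx.
by move=> /ltE /gap_lt_trans /(_ ji); rewrite gap_ltxx.
Qed.

End Occupied.

Lemma card_shi_avoids0 k : (n + k = m.+2)%N ->
  #|[set p | shi_valid p && avoids p 0]| = (k ^ n)%N.
Proof.
move=> nk; rewrite -[in RHS](card_ord k) -[in RHS](card_ord n) -card_ffun.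
rewrite -cardsT -(card_imset _ (place_inj nk)).
apply: eq_card => p; rewrite inE.
apply/idP/imsetP => [/andP[v p0]|[f _ ->]]; last exact: place_valid.
by have [f ->] := place_surj v p0 nk; exists f.
Qed.

Lemma card_shi_avoids k e : (n + k = m.+2)%N ->
  #|[set p | shi_valid p && avoids p e]| = (k ^ n)%N.
Proof.
move=> nk; rewrite -(card_shi_avoids0 nk).
(* Rotation by e preserves validity and carries the empty place 0 to e. *)
pose t p : {ffun 'I_n -> 'I_m.+2} := [ffun i => p i + e].
have t_inj : injective t.
  move=> p p' /ffunP pp'; apply/ffunP => i.
  by have := pp' i; rewrite !ffunE => /addIr.
rewrite -(card_preimset _ t_inj); apply: eq_card => p; rewrite !inE.
congr (_ && _).
  apply: eq_forallb => i; apply: eq_forallb => j; rewrite !ffunE addrAC.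
  by rewrite !(inj_eq (addIr _)).
by apply: eq_forallb => i; rewrite ffunE -[X in _ != X]add0r (inj_eq (addIr _)).
Qed.

(** Double counting of pairs of a valid p and a place e that it avoids: p is injective, so it leaves
    exactly k places empty. *)
Lemma card_shi_valid k : (n + k = m.+2)%N ->
  (#|[set p | shi_valid p]| * k = m.+2 * k ^ n)%N.
Proof.
move=> nk.
transitivity (\sum_(p | shi_valid p) \sum_e avoids p e)%N.
  rewrite -sum_nat_const; under eq_bigl do rewrite inE.
  apply: eq_bigr => p v.
  have -> : (\sum_e avoids p e = #|~: [set p i | i : 'I_n]|)%N.
    rewrite -sum1_card [RHS]big_mkcond; apply: eq_bigr => e _.
    rewrite !inE; congr nat_of_bool.
    apply/forallP/idP => [pe|/imsetP pe i].
      by apply/imsetP => -[i _ ei]; have := pe i; rewrite ei eqxx.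
    by apply/eqP => ei; apply: pe; exists i.
  rewrite cardsCs finset.setCK card_imset ?card_ord; first by lia.
  exact: shi_valid_inj.
rewrite exchange_big /= -[m.+2 in RHS]card_ord -sum_nat_const.
apply: eq_bigr => e _; rewrite -(card_shi_avoids e nk) -sum1_card big_mkcond.
rewrite [RHS]big_mkcond; apply: eq_bigr => p _; rewrite inE.
by case: shi_valid; case: avoids.
Qed.

End ShiPlacements.

(** * The finite field method *)

Local Open Scope classical_set_scope.
Local Open Scope ring_scope.

Lemma sum_mobius (d : Order.disp_t) (P : finPOrderType d) (x y : P) :
  (x <= y)%O -> \sum_(z : P | (x <= z <= y)%O) mobius x z = (x == y)%:R.
Proof.
move=> xy; rewrite (bigD1 y) ?xy ?lexx //=.
under eq_bigl => z do rewrite -andbA [_ && (z != y)]andbC -lt_neqAle.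
have [<-|ne] := eqVneq x y.
  rewrite mobiusxx big1 ?addr0 // => z /andP[/le_lt_trans h /h].
  by rewrite ltxx.
by rewrite mobius_lt ?addNr // lt_neqAle ne.
Qed.

Section FiniteFieldMethod.
Variables (R : realType) (n : nat) (A : arrangement R n).
Implicit Types X Y : intersection_poset A.

Lemma hyperplane_neqT (H : set 'rV[R]_n) : is_hyperplane H -> H <> setT.
Proof.
move=> [a [b [a0 ->]]] HT; have [i ai] : exists i, a 0 i != 0.
  by apply/existsP; apply: contraNT a0 => /existsPn ai; apply/eqP/rowP => i;
     rewrite mxE; apply/eqP/negPn/ai.
have at_pt (y : 'rV[R]_n) : \sum_(i < n) a 0 i * y 0 i = b.
  by have : [set: 'rV[R]_n] y by []; rewrite -HT.
have := at_pt (delta_mx 0 i).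
rewrite -(at_pt 0) [RHS]big1 => [|j _]; last first.
  by rewrite mxE mulr0.
rewrite (bigD1 i) //= big1 => [|j ji];
  rewrite mxE ?(negbTE ji) ?andbF ?mulr0 //.
by rewrite !eqxx mulr1 addr0 => /eqP; rewrite (negbTE ai).
Qed.

Lemma flat_setP X : exists2 B : {fset set 'rV[R]_n},
  (B `<=` hyperplanes A)%fset & flat_set X = \bigcap_(H in [set` B]) H.
Proof.
have := valP X; rewrite !inE /= => /andP[/imfsetP[B /=]].
by rewrite fpowersetE => BA XB _; exists B.
Qed.

Lemma flat_set_nonempty X : flat_set X !=set0.
Proof. by have := valP X; rewrite !inE /= => /andP[_ /set0P]. Qed.

(** The witness is the intersection of all hyperplanes through y, the smallest flat containing y. It
    is the whole space only if no hyperplane passes through y, by [hyperplane_neqT]. *)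
Lemma flat_atP (y : 'rV[R]_n) : exists X,
  (forall Z, (Z <= X)%O = `[< flat_set Z y >]) /\
  (X == \bot%O) = `[< forall H, H \in hyperplanes A -> ~ H y >].
Proof.
pose B := [fset H in hyperplanes A | `[< H y >]]%fset.
have BE H : (H \in B) = (H \in hyperplanes A) && `[< H y >] by rewrite !inE.
have By : (\bigcap_(H in [set` B]) H) y.
  by move=> H /=; rewrite BE => /andP[_ /asboolP].
have BF : \bigcap_(H in [set` B]) H \in flats A.
  rewrite !inE /=; apply/andP; split; last by apply/set0P; exists y.
  apply/imfsetP; exists B => //=; rewrite fpowersetE; apply/fsubsetP => H.
  by rewrite BE => /andP[].
pose X : intersection_poset A := [` BF]%fset.
have XE : flat_set X = \bigcap_(H in [set` B]) H by [].
exists X; split.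
  move=> Z; apply/asboolP/asboolP; rewrite XE; first by apply.
  have [C CA ->] := flat_setP Z => Cy x Bx H /= HC; apply: Bx => /=.
  by rewrite BE (fsubsetP CA) //; apply/asboolP; apply: Cy.
apply/eqP/asboolP => [X0 H HA Hy|noH].
  apply: (hyperplane_neqT (hyperplanesP HA)); apply/seteqP; split => // x _.
  have : flat_set X x by rewrite X0.
  by rewrite XE; apply; rewrite /= BE HA; apply/asboolP.
apply/eqP; rewrite -lex0; apply/asboolP => x _; rewrite XE => H /=.
by rewrite BE => /andP[/noH nHy /asboolP].
Qed.

(** The flats through y form an interval starting at the bottom, over which the Möbius function sums
    to 0 unless the interval is a point. *)
Lemma sum_mobius_through (y : 'rV[R]_n) :
  \sum_(X : intersection_poset A | `[< flat_set X y >])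
     mobius (\bot%O : intersection_poset A) X =
  `[< forall H, H \in hyperplanes A -> ~ H y >]%:R.
Proof.
have [X [leX <-]] := flat_atP y.
rewrite eq_sym -(sum_mobius (le0x X)); apply: eq_bigl => Z.
by rewrite le0x leX.
Qed.

Lemma flat_dim_le X : (flat_dim X <= n)%N.
Proof.
by rewrite /flat_dim (leq_trans (dimvS (subvf _))) // dimvf /dim /= mul1n.
Qed.

(** The points of T stand for vectors over Z/q, seen through real representatives [Y t]. Replace
    each power of q by a count of points and exchange the sums. *)
Lemma characteristic_poly_count (T : finType) (q : nat) (Y : T -> 'rV[R]_n) :
  (forall X, #|[set t | `[< flat_set X (Y t) >]]%SET| = (q ^ flat_dim X)%N) ->
  (characteristic_poly A).[q%:R] =
  #|[set t | `[< forall H, H \in hyperplanes A -> ~ H (Y t) >]]%SET|%:R.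
Proof.
move=> cardX; rewrite /characteristic_poly horner_sum.
transitivity (\sum_(X : intersection_poset A) \sum_(t | `[< flat_set X (Y t) >])
   mobius (\bot%O : intersection_poset A) X).
  apply: eq_bigr => X _.
  rewrite hornerZ hornerXn /flat_rank subKn ?flat_dim_le //.
  rewrite -natrX -cardX sumr_const mulr_natr; congr (_ *+ _).
  by apply: eq_card => t; rewrite inE.
under eq_bigr do rewrite big_mkcond.
rewrite exchange_big /= -sum1_card natr_sum [RHS]big_mkcond.
apply: eq_bigr => t _; rewrite -big_mkcond sum_mobius_through inE.
by case: ifP.
Qed.

End FiniteFieldMethod.

(** Here c sends a vertex to its connected component and s picks a representative. The type T is
    free because the lemma serves both for real coordinates and for residues. *)
Lemma components (n : nat) (e : rel 'I_n) :
  exists (k : nat) (s : 'I_k -> 'I_n) (c : 'I_n -> 'I_k), cancel s c /\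
  forall (T : Type) (u : 'I_n -> T),
    (forall i j, e i j -> u i = u j) <-> (forall i, u i = u (s (c i))).
Proof.
pose es := [rel i j | e i j || e j i].
have es_sym : connect_sym es by apply: sym_connect_sym => i j; rewrite /= orbC.
pose K := [set i | roots es i]%SET.
have rootK i : fingraph.root es i \in K by rewrite inE roots_root.
exists #|K|, enum_val, (fun i => enum_rank_in (rootK i) (fingraph.root es i)).
split=> [a|T u].
  have /eqP rE : roots es (enum_val a) by have := enum_valP a; rewrite inE.
  by apply: enum_val_inj; rewrite enum_rankK_in ?rootK.
split=> [ue i|ur i j eij].
  rewrite enum_rankK_in //.
  have /connectP[p] := connect_root es i.
  elim: p i => [|j p IHp] i /=; first by move=> _ ->.
  move=> /andP[eij jp] last_eq.
  have -> : u i = u j by case/orP: eij => /ue ->.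
  have -> : fingraph.root es i = fingraph.root es j.
    by apply/(fingraph.rootP es_sym); apply: connect1.
  apply: IHp => //; rewrite -last_eq; apply/esym/(fingraph.rootP es_sym).
  exact: connect1.
rewrite ur [RHS]ur !enum_rankK_in //; congr u.
by apply/(fingraph.rootP es_sym)/connect1; rewrite /= eij.
Qed.

(** [direction] chooses a subspace by [xget]; equal cosets have equal subspaces, so the choice is
    forced. *)
Lemma direction_coset (R : realType) (n : nat) (p : 'rV[R]_n)
    (U : {vspace 'rV[R]_n}) :
  direction [set x | x - p \in U] = U.
Proof.
rewrite /direction; case: xgetP => [V _ [p' UV]|/(_ U)]; last by case; exists p.
have memE x : (x - p \in U) = (x - p' \in V).
  apply/idP/idP => h.
    by have : [set x | x - p \in U] x by []; rewrite UV.
  by have : [set x | x - p' \in V] x by []; rewrite -UV.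
have pV : p - p' \in V by rewrite -memE subrr mem0v.
apply/vspaceP => x; have := memE (x + p); rewrite addrK => ->.
by rewrite -addrA rpredDr.
Qed.

(** * The Shi arrangement *)

Lemma flat_dim_coset (R : realType) (n k : nat) (A : arrangement R n)
    (X : intersection_poset A) (z : 'rV[R]_n) (s : 'I_k -> 'I_n)
    (c : 'I_n -> 'I_k) :
  cancel s c ->
  flat_set X = [set x | forall i, (x - z) 0 i = (x - z) 0 (s (c i))] ->
  flat_dim X = k.
Proof.
move=> sK XE.
(* F copies one coordinate per component to all its vertices: it is injective because [s] is a
   section of [c], and its image is the direction of the flat. *)
have [F FE] : exists F : 'Hom('rV[R]_k, 'rV[R]_n),
    forall w, F w = \row_i w 0 (c i).
  pose f (w : 'rV[R]_k) : 'rV[R]_n := \row_i w 0 (c i).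
  have f_lin : linear f by move=> a v w; apply/rowP => i; rewrite !mxE.
  pose fL := GRing.isLinear.Build _ _ _ _ f f_lin.
  pose fM : {linear 'rV[R]_k -> 'rV[R]_n} := HB.pack f fL.
  by exists (linfun fM) => w; rewrite (lfunE fM).
rewrite /flat_dim; have -> : flat_set X = [set x | x - z \in limg F].
  rewrite XE; apply/seteqP; split=> x /= xP.
    apply/memv_imgP; exists (\row_j (x - z) 0 (s j)); rewrite ?memvf // FE.
    by apply/rowP => i; rewrite [LHS]xP [RHS]mxE [RHS]mxE.
  have /memv_imgP[w _ ->] := xP.
  by move=> i; rewrite FE !mxE sK.
rewrite direction_coset limg_dim_eq ?dimvf /dim /= ?mul1n //.
rewrite capfv; apply/eqP/lker0P => v w; rewrite !FE => /rowP vw.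
by apply/rowP => j; have := vw (s j); rewrite !mxE sK.
Qed.

Section ShiCount.
Variables (R : realType) (n m : nat).
Hypothesis nm : (n < m.+2)%N.
Implicit Types p : {ffun 'I_n -> 'I_m.+2}.

Lemma shi_hyperplaneP (H : set 'rV[R]_n) : H \in hyperplanes (shi R n) <->
  exists (i j : 'I_n) (c : bool), (i < j)%N /\ H = shi_hyperplane i j c%:R.
Proof.
rewrite inE; split.
  by case/orP => /imfsetP[[i j] /=]; rewrite inE /= => ij ->;
     [exists i, j, false | exists i, j, true].
move=> [i [j [c [ij ->]]]]; apply/orP; case: c; [right|left].
  by apply/imfsetP; exists (i, j).
by apply/imfsetP; exists (i, j).
Qed.

Definition empty_place p : 'I_m.+2 := odflt 0 [pick e | avoids p e].

(** By pigeonhole, since n < m + 2, the search for an avoided place succeeds. *)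
Lemma empty_placeP p i : p i != empty_place p.
Proof.
rewrite /empty_place; case: pickP => [e /forallP//|no] /=.
have : (#|[set p i | i : 'I_n]%SET| < #|'I_m.+2|)%N.
  by apply: leq_ltn_trans (leq_imset_card _ _) _; rewrite !card_ord.
rewrite ltnNge -cardsT subset_leq_card //; apply/fintype.subsetP => e _.
have /forallPn[j] := negbT (no e).
by rewrite negbK => /eqP <-; apply/imsetP; exists j.
Qed.

(** The subtraction is modulo m + 2: the circle is rotated to bring the empty place to 0, then
    residues are read as naturals. *)
Definition cut_nat p (i : 'I_n) : nat := (p i - empty_place p)%R.

Definition cut p : 'rV[R]_n := \row_i (cut_nat p i)%:R.

(** No label sits at 0 after the rotation, so adding 1 never wraps onto a label, and the congruence
    and the real equation say the same. *)
Lemma cut_shi p i j (c : bool) :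
  shi_hyperplane i j c%:R (cut p) <-> p i = p j + c%:R.
Proof.
rewrite /shi_hyperplane /= !mxE.
have -> : (cut_nat p i)%:R - (cut_nat p j)%:R = c%:R :> R <->
    cut_nat p i = (cut_nat p j + c)%N.
  split=> [/eqP|->]; last by rewrite natrD addrC addKr.
  by rewrite subr_eq addrC -natrD eqr_nat => /eqP.
have cut_gt0 l : (0 < cut_nat p l)%N.
  rewrite lt0n; apply/negP => /eqP cl0; have /eqP := empty_placeP p l; apply.
  by apply/eqP; rewrite -subr_eq0; apply/eqP/val_inj.
have cutE : p i = p j + c%:R <->
    p i - empty_place p = p j - empty_place p + c%:R.
  by rewrite addrAC; split=> [->|/addIr].
rewrite cutE; case: c {cutE}; rewrite /= ?addn0 ?addr0; last first.
  by split=> [/val_inj//|]; rewrite /cut_nat => ->.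
have valE l : val (p l - empty_place p) = cut_nat p l by [].
have cut_lt : (cut_nat p i < m.+2)%N by apply: ltn_ord.
rewrite addn1; split=> [ij|/(congr1 val)]; last first.
  rewrite val_Zp_add1 !valE; case: eqP => // _ ci.
  by have := cut_gt0 i; rewrite ci.
apply: val_inj; rewrite val_Zp_add1 !valE ij; case: eqP => // cj.
by move: cut_lt; rewrite ij cj ltnn.
Qed.

(** On the flat and modulo m + 2 alike, the solutions are one particular solution plus a function
    constant on the components of the graph [e]. Their number k is the dimension. *)
Lemma card_cut_flat (X : intersection_poset (shi R n)) :
  #|[set p | `[< flat_set X (cut p) >]]%SET| = (m.+2 ^ flat_dim X)%N.
Proof.
have [B BA XE] := flat_setP X; have [z Xz] := flat_set_nonempty X.
have BE H : H \in B -> exists i j (c : bool), H = shi_hyperplane i j c%:R.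
  by move=> /(fsubsetP BA)/shi_hyperplaneP[i [j [c [_ ->]]]]; exists i, j, c.
pose e i j := [exists c : bool, shi_hyperplane i j c%:R \in B].
have [k [s [c [sK compP]]]] := components e.
have zB i j (b : bool) : shi_hyperplane i j b%:R \in B -> z 0 i = z 0 j + b%:R.
  move=> HB; have : shi_hyperplane i j b%:R z by move: Xz; rewrite XE; apply.
  by rewrite /shi_hyperplane /= => <-; rewrite addrC subrK.
rewrite (@flat_dim_coset _ _ k _ X z s c sK); last first.
  rewrite XE; apply/seteqP; split=> x /= xB.
    apply/compP => i j /existsP[b HB]; rewrite !mxE (zB _ _ _ HB).
    have := xB _ HB; rewrite /shi_hyperplane /= => <-.
    by ring.
  move=> H /= HB; have [i [j [b HE]]] := BE _ HB; subst H.
  have /compP/(_ i j) : forall i, (x - z) 0 i = (x - z) 0 (s (c i)) := xB.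
  rewrite !mxE (zB _ _ _ HB) => h; rewrite /shi_hyperplane /=.
  have := h _; move/(_ (introT existsP (ex_intro _ b HB))) => xz.
  apply/eqP; rewrite subr_eq; apply/eqP.
  by rewrite -[LHS](subrK (z 0 j + b%:R)) xz; ring.
(* A point z of X has integer differences along the edges of [e], so the floors of its coordinates
   solve the same equations modulo m + 2. *)
pose y i : 'I_m.+2 := (Num.floor (z 0 i))%:~R.
have yB i j (b : bool) : shi_hyperplane i j b%:R \in B -> y i = y j + b%:R.
  move=> /zB zij; rewrite /y zij floorDrz ?rpred_nat //.
  by rewrite rmorphD /= -[b%:R in LHS]/((b : nat)%:Z%:~R) intrKfloor.
pose g (w : {ffun 'I_k -> 'I_m.+2}) : {ffun 'I_n -> 'I_m.+2} :=
  [ffun i => w (c i) + y i].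
have g_inj : injective g.
  move=> w w' /ffunP ww'; apply/ffunP => j; have := ww' (s j).
  by rewrite !ffunE sK => /addIr.
rewrite -[in RHS](card_ord k) -[in RHS](card_ord m.+2) -card_ffun -cardsT.
rewrite -(card_imset _ g_inj); apply: eq_card => p; rewrite inE.
have -> : `[< flat_set X (cut p) >] =
    `[< forall i, p i - y i = p (s (c i)) - y (s (c i)) >].
  apply: asbool_equiv_eq; rewrite -(compP _ (fun i => p i - y i)) XE; split.
    move=> pB i j /existsP[b HB]; have /cut_shi := pB _ HB.
    by rewrite (yB _ _ _ HB) => ->; ring.
  move=> h H /= HB; have [i [j [b HE]]] := BE _ HB; subst H.
  apply/cut_shi; have /h : e i j by apply/existsP; exists b.
  rewrite (yB _ _ _ HB) => /(congr1 (fun t => t + (y j + b%:R))).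
  by rewrite subrK => ->; ring.
apply/asboolP/imsetP => [h|[w _ -> i]]; last by rewrite !ffunE sK !addrK.
exists [ffun j => p (s j) - y (s j)] => //.
by apply/ffunP => i; rewrite !ffunE -h subrK.
Qed.

Lemma shi_characteristic_count : (characteristic_poly (shi R n)).[m.+2%:R] =
  #|[set p : {ffun 'I_n -> 'I_m.+2} | shi_valid p]%SET|%:R.
Proof.
rewrite (characteristic_poly_count card_cut_flat); congr _%:R.
apply: eq_card => p; rewrite !inE; apply/asboolP/shi_validP => h.
  move=> i j ij; have hc (c : bool) : p i <> p j + c%:R.
    move=> pij; apply: (h (shi_hyperplane i j c%:R)); last exact/cut_shi.
    by apply/shi_hyperplaneP; exists i, j, c.
  by split; apply/eqP; [have := hc false; rewrite addr0 | apply: (hc true)].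
move=> H /shi_hyperplaneP[i [j [c [/h[/eqP h0 /eqP h1] ->]]]] /cut_shi.
by case: c; rewrite /= ?addr0.
Qed.

End ShiCount.

Lemma shi_characteristic_poly (R : realType) (n : nat) :
  map_poly intr (characteristic_poly (shi R n)) =
  if n is m.+1 then 'X * ('X - n%:R%:P) ^+ m else 1 :> {poly rat}.
Proof.
(* Moduli from n + 2 on have the form [q.+2] and exceed n, so their difference with n is nonzero and
   can be cancelled from [card_shi_valid]. *)
apply: (@eq_poly_nat _ n.+2) => [i j /eqP|[|[|q]] // nq].
  by rewrite eqr_nat => /eqP.
have -> : (q.+2%:R : rat) = (q.+2%:R : int)%:~R by rewrite rmorph_nat.
rewrite horner_map /= shi_characteristic_count; last by lia.
rewrite !rmorph_nat.
have := @card_shi_valid n q (q.+2 - n); rewrite subnKC; last by lia.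
move=> /(_ erefl) /(congr1 (fun t : nat => t%:R : rat)).
have kn0 : (q.+2 - n)%:R != 0 :> rat by rewrite pnatr_eq0; lia.
rewrite !natrM natrX => cardE; apply: (mulIf kn0); rewrite {}cardE.
case: n nq kn0 => [|n] nq kn0.
  by rewrite expr0 subn0 hornerC mulr1 mul1r.
rewrite hornerM horner_exp hornerD hornerN hornerX -polyC_natr hornerC exprSr.
rewrite natrB; last by lia.
by rewrite mulrA.
Qed.

Lemma shi_egfE (R : realType) : shi_egf R = abel_poly.
Proof.
apply: funext => n; rewrite /shi_egf shi_characteristic_poly.
by case: n => [|n] //; rewrite fact0 invr1 scale1r.
Qed.

Theorem theorem4p16 (R : realType) :
  (exists F : fps rat,
     fps_cvg (fun r => fps_div (A_ r) (A_ r.-1)) F /\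
     shi_egf R = fps_pow_indet F) /\
  fps_cvg (fun r => fps_div (A_ r.-1) (A_ r))
    (fun n => (-1) ^+ n * (n.+1%:R : rat) ^ (n%:Z - 1) / n`!%:R).
Proof.
split; last first.
  have := cvg_A_div_inv; congr fps_cvg; apply: funext => n.
  by rewrite abel_seriesN1.
exists (abel_series 1); split; first exact: cvg_A_div.
by rewrite shi_egfE abel_series_indet.
Qed.
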